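(* If a dynamical system $(X,f)$ has the almost specification property, then it has the asymptotic average shadowing property.
   Context: A dynamical system $(X,f)$ is a compact metric space $(X,d)$ together with a continuous map $f\colon X\to X$ (not assumed surjective). $\mathbb{N}=\{1,2,\dots\}$, $\mathbb{N}_0=\mathbb{N}\cup\{0\}$. Asymptotic average shadowing. A sequence $\{x_i\}_{i=0}^\infty\subset X$ is an asymptotic average pseudo-orbit of $f$ if $\lim_{n\to\infty}\frac1n\sum_{i=0}^{n-1}d(f(x_i),x_{i+1})=0$. $(X,f)$ has the asymptotic average shadowing property if for every asymptotic average pseudo-orbit $\{x_i\}_{i=0}^\infty$ there is $z\in X$ with $\lim_{n\to\infty}\frac1n\sum_{i=0}^{n-1}d(f^i(z),x_i)=0$. Almost specification. For $\varepsilon_0>0$, a function $g\colon\mathbb{N}_0\times(0,\varepsilon_0]\to\mathbb{N}$ is a mistake function if for all $\varepsilon\in(0,\varepsilon_0]$ and $n\in\mathbb{N}_0$ we have $g(n,\varepsilon)\le g(n+1,\varepsilon)$ and $\lim_{n\to\infty}g(n,\varepsilon)/n=0$; for $\varepsilon>\varepsilon_0$ set $g(n,\varepsilon)=g(n,\varepsilon_0)$. For $n$ with $g(n,\varepsilon)<n$ let $I(g;n,\varepsilon)=\{A\subset\{0,\dots,n-1\}:|A|\ge n-g(n,\varepsilon)\}$, and for $x\in X$ let $B_n(g;x,\varepsilon)$ be the set of $y\in X$ for which there is $A\in I(g;n,\varepsilon)$ with $\max_{j\in A}d(f^j(x),f^j(y))<\varepsilon$. The system $(X,f)$ has the almost specification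 property if there exist a mistake function $g$ and a function $k_g\colon(0,\infty)\to\mathbb{N}$ (with $g(n,\varepsilon)<n$ for all $n\ge k_g(\varepsilon)$, so that the sets below are defined) such that for any $m\ge1$, any $\varepsilon_1,\dots,\varepsilon_m>0$, any $x_1,\dots,x_m\in X$ and any integers $n_1\ge k_g(\varepsilon_1),\dots,n_m\ge k_g(\varepsilon_m)$, setting $n_0=0$ and $l_j=\sum_{s=0}^{j-1}n_s$ for $j=1,\dots,m$, there is $z\in X$ such that $f^{l_j}(z)\in B_{n_j}(g;x_j,\varepsilon_j)$ for every $j=1,\dots,m$. *)

(* Defs.v *)
From HB Require Import structures.
From mathcomp Require Import all_boot all_order all_algebra.
From mathcomp Require Import boolp classical_sets reals topology normedtype sequences.

Set Implicit Arguments.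
Unset Strict Implicit.
Unset Printing Implicit Defensive.

Import Order.TTheory GRing.Theory Num.Theory.
Import numFieldNormedType.Exports.

Local Open Scope classical_set_scope.
Local Open Scope ring_scope.

(* In the averages below the term of rank n = 0 is the junk value 0 / 0 = 0;
   it is irrelevant to the limit. *)

Definition asymptotic_average_pseudo_orbit (R : realType) (X : metricType R)
    (f : X -> X) (x : nat -> X) : Prop :=
  (fun n : nat => n%:R^-1 * \sum_(i < n) mdist (f (x i)) (x i.+1)) @ \oo
    --> (0 : R).

Definition asymptotic_average_shadowing (R : realType) (X : metricType R)
    (f : X -> X) : Prop :=
  forall x : nat -> X, asymptotic_average_pseudo_orbit f x ->
  exists z : X,
    (fun n : nat => n%:R^-1 * \sum_(i < n) mdist (iter i f z) (x i)) @ \oo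
      --> (0 : R).

(* g is total in its second argument, but only its values on ]0, e0] are
   meaningful; they are positive since mistake functions take values in
   {1, 2, ...}. *)
Definition mistake_function (R : realType) (e0 : R) (g : nat -> R -> nat) : Prop :=
  forall e : R, 0 < e -> e <= e0 ->
    [/\ forall n : nat, (0 < g n e)%N,
        forall n : nat, (g n e <= g n.+1 e)%N &
        (fun n : nat => (g n e)%:R / n%:R) @ \oo --> (0 : R)].

(* Convention g(n, e) = g(n, e0) for e > e0. *)
Definition mistake_ext (R : realType) (e0 : R) (g : nat -> R -> nat) (n : nat)
    (e : R) : nat :=
  g n (if e <= e0 then e else e0).

(* I(g; n, e); only meant for g n e < n, so that the subtraction is not
   truncated and every member is nonempty. *)
Definition mistake_sets (R : realType) (g : nat -> R -> nat) (n : nat) (e : R)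
    : set {set 'I_n} :=
  [set A : {set 'I_n} | (n - g n e <= #|A|)%N].

(* B_n(g; x, e); as distances are nonnegative, the default value 0 of the
   maximum plays no role on a nonempty A. *)
Definition mistake_ball (R : realType) (X : metricType R) (f : X -> X)
    (g : nat -> R -> nat) (n : nat) (x : X) (e : R) : set X :=
  [set y : X | exists2 A : {set 'I_n}, mistake_sets g e A &
     \big[Num.max/0]_(j in A) mdist (iter j f x) (iter j f y) < e].

(* The families (e_j), (x_j), (n_j) are indexed from 0 rather than from 1, so
   that l_j is the sum of the n_s over s < j and l_0 = 0. *)
Definition almost_specification (R : realType) (X : metricType R) (f : X -> X)
    : Prop :=
  exists (e0 : R) (g : nat -> R -> nat) (k : R -> nat),
    let g' := mistake_ext e0 g in
    [/\ 0 < e0,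
        mistake_function e0 g,
        forall e : R, 0 < e ->
          (0 < k e)%N /\ (forall n : nat, (k e <= n)%N -> (g' n e < n)%N) &
        forall (m : nat) (e : 'I_m -> R) (x : 'I_m -> X) (n : 'I_m -> nat),
          (1 <= m)%N ->
          (forall j : 'I_m, 0 < e j) ->
          (forall j : 'I_m, (k (e j) <= n j)%N) ->
          exists z : X, forall j : 'I_m,
            mistake_ball f g' (n j) (x j) (e j)
              (iter (\sum_(s < m | (s < j)%N) n s)%N f z)].

(* Main.v *)
Require Import Defs.
From HB Require Import structures.
From mathcomp Require Import all_boot all_order all_algebra.
From mathcomp Require Import boolp classical_sets reals topology normedtype sequences.
From mathcomp Require Import interval_inference zify lra.
Import Order.TTheory GRing.Theory Num.Theory.
Import numFieldNormedType.Exports.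
Local Open Scope classical_set_scope.
Local Open Scope ring_scope.

(** Cut time into consecutive blocks and let a single point z shadow, on the
    block starting at time l, the true orbit of x_l for as long as the block
    lasts.  Two errors arise on a block of length n.

    - The distance from z to the orbit of x_l.  A mistake function is sublinear
      in n and distances are bounded by the diameter, so a long enough block
      has average tracing error as small as desired ([mistake_ball_sum]).
      Almost specification only handles finitely many blocks, but the
      conditions on z expressed through these averages are closed, and
      compactness yields one z for an infinite list of blocks
      ([averaged_specification]).

    - The distance from the orbit of x_l to the pseudo-orbit.  For a fixed
      length n and a tolerance c there is a constant C such that this error,
      summed over the block, is at most n c + C times the sum of the jumps
      d(f x_i, x_{i+1}) over the block ([orbit_deviation_sum]).  Being linear
      in the jumps, the bound adds up over blocks.

    Smaller tolerances c_k need longer blocks n_k and larger constants C_k.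
    Since the sum J(N) of the first N jumps is o(N), for each fixed k both
    C_k J(N) and n_k are eventually negligible with respect to N.  A stage
    function kappa that tends to infinity slowly enough ([diagonal_stage])
    keeps C_{kappa N} J(N) and n_{kappa N} negligible as well.  Taking a block
    of length n_{kappa l} whenever a block starts at time l, all the errors
    together are o(N) ([staged_sum_sublinear]). *)

(** * Compact metric spaces *)

Lemma compact_mdist_bounded {R : realType} {X : metricType R} :
  compact [set: X] -> exists2 D : R, 0 < D & forall a b : X, mdist a b <= D.
Proof.
move=> /compact_near_coveringP Xcover.
have [[x0]|noX] := pselect (exists x0 : X, True); last first.
  by exists 1 => // a; case: noX; exists a.
have /Xcover[N _ hN] : forall x : X, [set: X] x ->
    \forall x' \near x & M \near \oo, mdist x0 x' <= M%:R.
  move=> x _; exists (ball x 1, [set M | mdist x0 x + 1 <= M%:R]).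
    by split; [exact: nbhsx_ballx|exact: nbhs_infty_ger].
  move=> [x' M] /= []; rewrite ballEmdist /= => xx' hM.
  by have := metric_triangle x0 x x'; lra.
have {}hN := hN N (leqnn N); exists (N%:R + N%:R + 1).
  by have := ler0n R N; lra.
move=> a b; have := metric_triangle a x0 b; rewrite (metric_sym a x0).
by have := hN a I; have := hN b I; rewrite /=; lra.
Qed.

(** Uniform continuity controls close pairs by e; for pairs at distance at
    least delta, the diameter D is at most (D / delta) times their distance.
    A bound linear in the distance, unlike an epsilon-delta statement, can be
    summed along a pseudo-orbit. *)
Lemma compact_almost_lipschitz {R : realType} {X : metricType R} {f : X -> X} :
  compact [set: X] -> continuous f -> forall e : R, 0 < e ->
  exists2 L : R, 0 <= L & forall a b, mdist (f a) (f b) <= e + L * mdist a b.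
Proof.
move=> cptX fcont e e0; have [D D0 hD] := compact_mdist_bounded cptX.
move: cptX => /compact_near_coveringP Xcover.
have /Xcover[N _ hN] : forall x : X, [set: X] x ->
    \forall x' \near x & n \near \oo,
      forall b, mdist x' b < n.+1%:R^-1 -> mdist (f x') (f b) <= e.
  move=> x _.
  have : \forall y \near x, ball (f x) (e / 2) (f y).
    by apply: fcont; apply: nbhsx_ballx; lra.
  move=> /nbhs_ballP[d /= d0 hd].
  exists (ball x (d / 2), [set n | n.+1%:R^-1 < d / 2]).
    split; first by apply: nbhsx_ballx; lra.
    have d20 : 0 < d / 2 by lra.
    exact: (near_infty_natSinv_lt (PosNum d20)).
  move=> [x' n] /= []; rewrite ballEmdist /= => xx' hn b x'b.
  have /hd : ball x d x' by rewrite ballEmdist /=; lra.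
  have /hd : ball x d b.
    rewrite ballEmdist /=; have := metric_triangle x x' b.
    by have := lt_trans x'b hn; lra.
  rewrite !ballEmdist /= => ? ?.
  by have := metric_triangle (f x') (f x) (f b); rewrite (metric_sym (f x') (f x)); lra.
have {}hN := hN N (leqnn N).
exists (D * N.+1%:R); first by rewrite mulr_ge0 // ltW.
move=> a b; case: (ltP (mdist a b) N.+1%:R^-1) => [ab|ab].
  apply: (le_trans (hN a I b ab)).
  by rewrite lerDl !mulr_ge0 ?mdist_ge0 // ltW.
apply: (le_trans (hD _ _)); rewrite -mulrA; apply: ler_wpDl; first exact: ltW.
apply: ler_peMr; first exact: ltW.
by rewrite -ler_pdivrMl ?ltr0n // mulr1.
Qed.

(** The finite intersection property for the closed sets phi_j <= c_j, applied
    to a cluster point of solutions of longer and longer initial segments. *)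
Lemma compact_continuous_le {R : realType} {X : metricType R}
    (phi : nat -> X -> R) (c : nat -> R) :
  compact [set: X] -> (forall j, continuous (phi j)) ->
  (forall m : nat, exists z, forall j, (j < m)%N -> phi j z <= c j) ->
  exists z, forall j, phi j z <= c j.
Proof.
move=> cptX phicont /choice[z hz].
have [p [_ clp]] : [set: X] `&` cluster (z @ \oo) !=set0.
  by apply: cptX; exact: filterT.
exists p => j.
have closedj : closed [set y | phi j y <= c j].
  apply: (@preimage_closed _ _ (phi j) [set r | r <= c j]).
    by move=> y _; exact: phicont.
  exact: closed_le.
apply: closedj => U Up; apply: clp => //.
by exists j.+1 => // m jm; exact: hz.
Qed.

Lemma continuous_iter {X : topologicalType} (f : X -> X) (n : nat) :
  continuous f -> continuous (iter n f).
Proof.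
move=> fcont; elim: n => [|n IH] x; first exact: cvg_id.
by apply: (@continuous_comp _ _ _ (iter n f) f); [exact: IH|exact: fcont].
Qed.

Lemma continuous_mdist {R : realType} {X : metricType R} (a : X) :
  continuous (mdist a : X -> R).
Proof.
move=> x; apply/cvgrPdist_lt => e e0.
near=> y.
have : ball x e y by near: y; exact: nbhsx_ballx.
rewrite ballEmdist /= => xy.
have := metric_triangle a x y; have := metric_triangle a y x.
by rewrite (metric_sym y x) ltr_norml; lra.
Unshelve. all: by end_near. Qed.

Lemma continuous_sum_mdist {R : realType} {X : metricType R} {f : X -> X}
    (n l : nat) (p : nat -> X) : continuous f ->
  continuous (fun z => \sum_(i < n) mdist (p i) (iter (i + l) f z) : R).
Proof.
move=> fcont; elim: n => [|n IH] z.
  under eq_fun do rewrite big_ord0.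
  exact: cvg_cst.
under eq_fun do rewrite big_ord_recr /=.
apply: cvgD; first exact: IH.
apply: (@continuous_comp _ _ _ (iter (n + l) f) (mdist (p n))).
  exact: continuous_iter.
exact: continuous_mdist.
Qed.

(** * Pseudo-orbits over a fixed time span *)

(** Each step of the comparison applies f, which multiplies the deviation
    by at most a Lipschitz factor L up to a small error, and then adds one jump;
    the error allowed at step n is chosen small compared with 1 / (L + 1). *)
Lemma orbit_deviation {R : realType} {X : metricType R} {f : X -> X} :
  compact [set: X] -> continuous f -> forall (n : nat) (e : R), 0 < e ->
  exists2 C : R, 0 <= C & forall u : nat -> X,
    mdist (iter n f (u 0)) (u n) <=
      e + C * \sum_(s < n) mdist (f (u s)) (u s.+1).
Proof.
move=> cptX fcont; elim=> [|n IH] e e0.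
  by exists 0 => // u; rewrite big_ord0 /= mdistxx; lra.
have e20 : 0 < e / 2 by lra.
have [L L0 hL] := compact_almost_lipschitz cptX fcont _ e20.
have e'0 : 0 < e / 2 / (L + 1) by rewrite divr_gt0 //; lra.
have [C C0 hC] := IH _ e'0.
exists (L * C + 1); first by rewrite addr_ge0 // mulr_ge0.
move=> u; rewrite big_ord_recr /=.
have J0 : 0 <= \sum_(s < n) mdist (f (u s)) (u s.+1).
  by apply: sumr_ge0 => i _; exact: mdist_ge0.
have Jn0 := mdist_ge0 (f (u n)) (u n.+1).
have tri := metric_triangle (f (iter n f (u 0))) (f (u n)) (u n.+1).
have := hL (iter n f (u 0)) (u n).
have := ler_wpM2l L0 (hC u).
have Le : L * (e / 2 / (L + 1)) <= e / 2.
  by rewrite mulrA ler_pdivrMr; nra.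
have : 0 <= L * C * mdist (f (u n)) (u n.+1) by rewrite !mulr_ge0.
by nra.
Qed.

Lemma orbit_deviation_sum {R : realType} {X : metricType R} {f : X -> X} :
  compact [set: X] -> continuous f -> forall (n : nat) (e : R), 0 < e ->
  exists2 C : R, 0 <= C & forall u : nat -> X,
    \sum_(i < n) mdist (iter i f (u 0)) (u i) <=
      n%:R * e + C * \sum_(s < n) mdist (f (u s)) (u s.+1).
Proof.
move=> cptX fcont n e e0; elim: n => [|n [C C0 hC]].
  by exists 0 => // u; rewrite !big_ord0; lra.
have [C' C'0 hC'] := orbit_deviation cptX fcont n _ e0.
exists (C + C'); first exact: addr_ge0.
move=> u; rewrite !big_ord_recr /= -[n.+1%:R]natr1.
have := hC u; have := hC' u; have := mdist_ge0 (f (u n)) (u n.+1).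
set J := \sum_(s < n) mdist (f (u s)) (u s.+1) => Jn0.
by have := mulr_ge0 C0 Jn0; have := mulr_ge0 C'0 Jn0; lra.
Qed.

(** * Sublinear sequences and stage functions *)

Lemma avg_cvg0P {R : realType} (F : nat -> R) : (forall n, 0 <= F n) ->
  (fun n : nat => n%:R^-1 * F n) @ \oo --> (0 : R) <->
  forall e : R, 0 < e -> \forall n \near \oo, F n <= e * n%:R.
Proof.
move=> F0; rewrite cvgr0Pnorm_le.
have FE n : (0 < n)%N -> forall e : R,
    (`|n%:R^-1 * F n| <= e) = (F n <= e * n%:R).
  move=> n0 e; rewrite ger0_norm ?mulr_ge0 ?invr_ge0 //.
  by rewrite ler_pdivrMl ?ltr0n // mulrC.
by split=> h e e0; apply: filterS2 (nbhs_infty_gt 0) (h e e0) => n n0;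
  rewrite FE.
Qed.

(** The diagonal argument: kappa N is the largest k <= N whose property P k is
    known to hold from time N on. *)
Lemma diagonal_stage (P : nat -> nat -> Prop) :
  (forall k, \forall N \near \oo, P k N) ->
  exists kappa : nat -> nat, [/\ {homo kappa : m n / (m <= n)%N},
    forall k, \forall N \near \oo, (k <= kappa N)%N &
    \forall N \near \oo, P (kappa N) N].
Proof.
move=> evP.
have {evP} /choice[M hM] : forall k, exists M, forall N, (M <= N)%N -> P k N.
  by move=> k; have [M _ hM] := evP k; exists M.
exists (fun N => \max_(k < N.+1 | (M k <= N)%N) k); split.
- move=> m n mn; apply/bigmax_leqP => k Mk.
  apply: (@leq_trans (widen_ord (mn : (m.+1 <= n.+1)%N) k)) => //.
  by apply: leq_bigmax_cond; exact: leq_trans Mk mn.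
- move=> k; exists (maxn k (M k)) => // N /=; rewrite geq_max => /andP[kN MN].
  by apply: (@leq_bigmax_cond _ _ _ (Ordinal (kN : (k < N.+1)%N))).
- exists (M 0) => // N /= M0N.
  have [|i iP ->] := @eq_bigmax_cond _
      [pred k : 'I_N.+1 | (M k <= N)%N] (fun k => k : nat).
    by apply/card_gt0P; exists ord0.
  by apply: hM.
Qed.

(** * Tracing infinitely many blocks *)

(** Off the mistakes the distance is less than e; each of the at most g n e
    mistakes costs at most the diameter. *)
Lemma mistake_ball_sum {R : realType} {X : metricType R} {f : X -> X}
    {g : nat -> R -> nat} {n : nat} {x y : X} {e D : R} :
  (forall a b : X, mdist a b <= D) -> (g n e <= n)%N ->
  mistake_ball f g n x e y ->
  \sum_(j < n) mdist (iter j f x) (iter j f y) <= n%:R * e + (g n e)%:R * D.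
Proof.
move=> hD gn [A /= cardA /bigmax_ltP[e0 dA]].
have D0 : 0 <= D by apply: le_trans (mdist_ge0 x y) (hD _ _).
rewrite (bigID (mem A)) /= lerD //.
  apply: (@le_trans _ _ (\sum_(j in A) e)).
    by apply: ler_sum => j /dA /ltW.
  rewrite sumr_const -(mulr_natl e) ler_wpM2r ?(ltW e0) // ler_nat.
  by rewrite -[X in (_ <= X)%N]card_ord max_card.
apply: (@le_trans _ _ (\sum_(j in ~: A) D)).
  rewrite (eq_bigl (fun j => j \in ~: A)) => [|j]; last by rewrite /= finset.in_setC.
  by apply: ler_sum => j _.
rewrite sumr_const -(mulr_natl D) ler_wpM2r // ler_nat.
move: cardA; rewrite /mistake_sets /= => cardA.
by rewrite cardsCs finset.setCK card_ord leq_subCl.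
Qed.

(** Almost specification with the mistake sets averaged away, for an infinite
    list of blocks: block j has type s j, which fixes its length n (s j) and
    its average error c (s j), and follows the orbit of p j. *)
Lemma averaged_specification {R : realType} {X : metricType R} {f : X -> X} :
  compact [set: X] -> continuous f -> almost_specification f ->
  forall c : nat -> R, (forall k, 0 < c k) ->
  exists2 n : nat -> nat, forall k, (0 < n k)%N &
    forall (s : nat -> nat) (p : nat -> X), exists z, forall j,
      \sum_(i < n (s j))
        mdist (iter i f (p j)) (iter (i + \sum_(t < j) n (s t)) f z) <=
      (n (s j))%:R * c (s j).
Proof.
move=> cptX fcont [e0 [g [K [e00 mistg KP spec]]]] c c0.
have [D D0 hD] := compact_mdist_bounded cptX.
have /choice[ne hne] : forall k, exists ne : nat * R, let: (n, e) := ne in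
    [/\ 0 < e, (K e <= n)%N &
        n%:R * e + (mistake_ext e0 g n e)%:R * D <= n%:R * c k].
  move=> k; pose e := Num.min e0 (c k / 2).
  have ck0 := c0 k.
  have e_gt0 : 0 < e by rewrite lt_min e00; lra.
  have ee0 : e <= e0 by rewrite ge_min lexx.
  have eck : e <= c k / 2 by rewrite ge_min lexx orbT.
  have [_ _ glim] := mistg e e_gt0 ee0.
  (* Half of the error c k is granted to the tolerance e, half to the
     mistakes, each of which costs up to D. *)
  have : \forall n \near \oo, (g n e)%:R <= c k / 2 / D * n%:R.
    apply: (avg_cvg0P (fun n => (g n e)%:R) (fun n => ler0n R (g n e))).1.
      by under eq_fun do rewrite mulrC.
    by rewrite !divr_gt0.
  move=> [N _ hN]; exists (maxn N (K e), e); split=> //.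
    exact: leq_maxr.
  have {hN} := hN _ (leq_maxl N (K e)); set n := maxn _ _ => gn.
  rewrite /mistake_ext ee0.
  have gD : (g n e)%:R * D <= n%:R * (c k / 2).
    by rewrite -ler_pdivlMr //; apply: (le_trans gn); lra.
  have := ler_wpM2l (ler0n R n) eck; lra.
pose n k := (ne k).1; pose e k := (ne k).2.
have hn k : [/\ 0 < e k, (K (e k) <= n k)%N &
    (n k)%:R * e k + (mistake_ext e0 g (n k) (e k))%:R * D <= (n k)%:R * c k].
  by have := hne k; rewrite /n /e; case: (ne k).
exists n.
  move=> k; have [ek0 Kn _] := hn k.
  by have [K0 _] := KP _ ek0; exact: leq_trans Kn.
move=> s p.
apply: (@compact_continuous_le _ _ (fun j z => \sum_(i < n (s j))
    mdist (iter i f (p j)) (iter (i + \sum_(t < j) n (s t)) f z))) => //.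
  by move=> j; exact: (@continuous_sum_mdist _ _ _ _ _ (fun i => iter i f (p j))).
move=> m.
have [|||z hz] := spec m.+1 (fun j => e (s j)) (fun j => p j) (fun j => n (s j)).
- by [].
- by move=> j; have [] := hn (s j).
- by move=> j; have [] := hn (s j).
exists z => j jm; have := hz (Ordinal (ltnW jm : (j < m.+1)%N)) => /=.
rewrite -(big_ord_widen _ (fun t => n (s t)) (ltnW (ltnW jm : (j < m.+1)%N))).
have [ej0 Kj nj] := hn (s j).
have [_ /(_ _ Kj) gn] := KP _ ej0.
move=> /(mistake_ball_sum hD (ltnW gn)) hj.
under eq_bigr do rewrite iterD.
exact: le_trans hj nj.
Qed.

(** * Adding up the errors of the blocks *)

Lemma locate_block (l : nat -> nat) (j0 N : nat) :
  {homo l : i j / (i < j)%N} -> (l j0 <= N)%N ->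
  exists2 j, (j0 <= j)%N & (l j <= N < l j.+1)%N.
Proof.
move=> lmono; elim: N => [|N IH] jN.
  by exists j0 => //; rewrite jN (leq_ltn_trans _ (lmono j0 j0.+1 _)).
have [jN'|jN'] := leqP (l j0) N.
  have [j j0j /andP[jl jr]] := IH jN'.
  have [jr'|jr'] := ltnP N.+1 (l j.+1); first by exists j; lia.
  by exists j.+1; [lia|have := lmono j.+1 j.+2 (ltnSn _); lia].
by exists j0 => //; have := lmono j0 j0.+1 (ltnSn _); lia.
Qed.

(** The errors of the blocks add up to o(N).  Here S N is the total shadowing
    error and J N the total jump up to time N,
    and l j is the start of block j.  The monotonicity of C and kappa lets the
    contributions C_k (J (l_{j+1}) - J (l_j)) telescope into C_{kappa (l_j)}
    J (l_j), which is negligible; the block in progress at time N has negligible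
    length and costs at most D per unit of time. *)
Lemma staged_sum_sublinear {R : realType} (D : R) (S J C c : nat -> R)
    (n kappa l : nat -> nat) :
  0 <= D -> (forall a m, S (a + m)%N <= S a + D * m%:R) ->
  (forall N, 0 <= J N) -> {homo C : k k' / (k <= k')%N >-> k <= k'} ->
  (forall k, (0 < n k)%N) -> {homo kappa : N N' / (N <= N')%N} ->
  (forall j, l j.+1 = l j + n (kappa (l j)))%N ->
  (forall j, S (l j.+1) <= S (l j) + (n (kappa (l j)))%:R * c (kappa (l j)) +
     C (kappa (l j)) * (J (l j.+1) - J (l j))) ->
  (forall e, 0 < e -> \forall N \near \oo, c (kappa N) <= e) ->
  (\forall N \near \oo, C (kappa N) * J N <= c (kappa N) * N%:R /\
     D * (n (kappa N))%:R <= c (kappa N) * N%:R) ->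
  (forall k, 0 <= C k) ->
  forall e, 0 < e -> \forall N \near \oo, S N <= e * N%:R.
Proof.
move=> D0 SD J0 Cmono n0 kmono lS Sblock csmall [N0 _ hP] C0 e e0.
have e40 : 0 < e / 4 by lra.
have [N1 _ hc] := csmall _ e40.
have llt : {homo l : i j / (i < j)%N}.
  apply: homo_ltn; first by move=> ? ? ?; exact: ltn_trans.
  by move=> j; rewrite lS -addn1 leq_add2l.
have lge j : (j <= l j)%N.
  by elim: j => // j IH; apply: leq_ltn_trans IH (llt _ _ _).
(* From block j0 on, all the asymptotic estimates are in force; what happened
   before contributes the constant S (l j0). *)
pose j0 := maxn N0 N1.
have late j : (j0 <= j)%N -> (N0 <= l j)%N /\ (N1 <= l j)%N.
  by have := lge j; rewrite /j0; lia.
have Sl j : (j0 <= j)%N ->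
    S (l j) <= S (l j0) + e / 4 * (l j)%:R + C (kappa (l j)) * J (l j).
  elim: j => [|j IH].
    rewrite leqn0 => /eqP ->; rewrite -addrA lerDl addr_ge0 ?mulr_ge0 //.
    exact: ltW.
  rewrite leq_eqVlt => /orP[/eqP <-|j0j].
    rewrite -addrA lerDl addr_ge0 ?mulr_ge0 //.
    exact: ltW.
  have {}IH := IH j0j; have [_ N1j] := late _ j0j.
  have cj := hc _ N1j; have nj0 := ler0n R (n (kappa (l j))).
  have Cj : C (kappa (l j)) <= C (kappa (l j.+1)).
    by apply/Cmono/kmono/ltnW/llt.
  have := ler_wpM2r (J0 (l j.+1)) Cj; have := ler_wpM2l nj0 cj.
  by have := Sblock j; rewrite [in (l j.+1)%:R]lS natrD /=; lra.
have [N2 _ hN2] := nbhs_infty_ger (S (l j0) / (e / 4)).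
exists (maxn N2 (l j0)) => // N /=; rewrite geq_max => /andP[N2N j0N].
have [j j0j /andP[jN Nj]] := locate_block l j0 N llt j0N.
have [N0j N1j] := late _ j0j.
have [CJ Dn] := hP _ N0j; have cj := hc _ N1j.
have ljN : (l j)%:R <= N%:R :> R by rewrite ler_nat.
have := ler_wpM2r (ler0n R (l j)) cj; have := ler_wpM2l (ltW e40) ljN.
have := hN2 _ N2N; rewrite /= ler_pdivrMr //.
have : D * (N - l j)%:R <= D * (n (kappa (l j)))%:R.
  by rewrite ler_wpM2l // ler_nat; have := lS j; lia.
by have := SD (l j) (N - l j)%N; rewrite subnKC //; have := Sl _ j0j; lra.
Qed.

Lemma sum_ordD {R : nmodType} (F : nat -> R) (a m : nat) :
  \sum_(i < a + m) F i = \sum_(i < a) F i + \sum_(i < m) F (a + i)%N.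
Proof. by rewrite big_split_ord. Qed.

Theorem corollary6p9 (R : realType) (X : metricType R) (f : X -> X)
  (X_compact : compact [set: X]) (f_continuous : continuous f)
  (f_almost_spec : almost_specification f) :
  asymptotic_average_shadowing f.
Proof.
have [D D0 hD] := compact_mdist_bounded X_compact.
move=> x.
have S0 z N : 0 <= \sum_(i < N) mdist (iter i f z) (x i).
  by apply: sumr_ge0 => i _; exact: mdist_ge0.
pose J N := \sum_(i < N) mdist (f (x i)) (x i.+1).
have J0 N : 0 <= J N by apply: sumr_ge0 => i _; exact: mdist_ge0.
move=> /(avg_cvg0P J J0).1 Jsmall.
pose c k : R := k.+1%:R^-1.
have c0 k : 0 < c k by rewrite invr_gt0 ltr0n.
have [n n0 spec] :=
  averaged_specification X_compact f_continuous f_almost_spec c c0.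
have /choice[C1 hC1] : forall k, exists C : R, 0 <= C /\ forall u : nat -> X,
    \sum_(i < n k) mdist (iter i f (u 0)) (u i) <=
      (n k)%:R * c k + C * \sum_(s < n k) mdist (f (u s)) (u s.+1).
  move=> k; have [C] := orbit_deviation_sum X_compact f_continuous (n k) _ (c0 k).
  by exists C.
(* Partial sums make the constants nondecreasing in the stage, so that those
   of past stages are bounded by the current one. *)
pose C k := \sum_(i < k.+1) C1 i.
have C_ge0 k : 0 <= C k by apply: sumr_ge0 => i _; have [] := hC1 i.
have C1C k : C1 k <= C k.
  by rewrite /C big_ord_recr /= lerDr; apply: sumr_ge0 => i _; have [] := hC1 i.
have Cmono : {homo C : k k' / (k <= k')%N >-> k <= k'}.
  apply: homo_leq => [k|k k' k''|k]; [exact: lexx|exact: le_trans|].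
  by rewrite [leRHS]/C big_ord_recr /= lerDl; have [] := hC1 k.+1.
have [|kappa [kmono kinfty kP]] := diagonal_stage
    (fun k N => C k * J N <= c k * N%:R /\ D * (n k)%:R <= c k * N%:R).
  move=> k.
  have CJ : 0 < c k / (C k + 1) by rewrite divr_gt0 // ltr_wpDl.
  apply: filterS2 (Jsmall _ CJ)
    (nbhs_infty_ger (D * (n k)%:R / c k)) => N JN nN; split.
    have C10 : 0 < C k + 1 by rewrite ltr_wpDl.
    apply: (@le_trans _ _ ((C k + 1) * J N)).
      by apply: ler_wpM2r => //; lra.
    by rewrite -ler_pdivlMl // mulrA (mulrC _^-1).
  by rewrite -ler_pdivrMl // mulrC.
pose l j := iter j (fun t => t + n (kappa t))%N 0%N.
have lE j : l j = (\sum_(t < j) n (kappa (l t)))%N.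
  by elim: j => [|j IH]; rewrite ?big_ord0 // big_ord_recr /= -IH.
have [z hz] := spec (fun j => kappa (l j)) (fun j => x (l j)).
exists z; apply/avg_cvg0P => //.
(* The factor 2 accounts for the two errors of a block: tracing and deviation
   each contribute c k on average, besides the jump term. *)
apply: (@staged_sum_sublinear _ D _ J C (fun k => 2 * c k) n kappa l) => //.
- exact: ltW.
- move=> a m; rewrite (sum_ordD (fun i => mdist (iter i f z) (x i))) lerD2l.
  rewrite mulr_natr -[in leRHS](card_ord m) -sumr_const.
  by apply: ler_sum => i _.
- move=> j; set k := kappa (l j).
  have -> : l j.+1 = (l j + n k)%N by [].
  rewrite /J (sum_ordD (fun i => mdist (iter i f z) (x i))).
  rewrite (sum_ordD (fun i => mdist (f (x i)) (x i.+1))).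
  rewrite -addrA lerD2l addrAC subrr add0r.
  have [_ /(_ (fun i => x (l j + i)%N))] := hC1 k; rewrite addn0.
  under [\sum_(s < _) mdist (f _) _]eq_bigr do rewrite addnS.
  have := hz j; rewrite -/k -lE => trace dev.
  apply: (@le_trans _ _ (\sum_(i < n k) (mdist (iter i f (x (l j)))
      (iter (i + l j) f z) + mdist (iter i f (x (l j))) (x (l j + i)%N)))).
    apply: ler_sum => i _; rewrite [(i + l j)%N]addnC.
    rewrite [in leRHS](metric_sym _ (iter (l j + i) f z)).
    exact: metric_triangle.
  rewrite big_split /=.
  set Jb := \sum_(i < n k) mdist (f _) _ in dev *.
  have Jb0 : 0 <= Jb by apply: sumr_ge0 => i _; exact: mdist_ge0.
  have := ler_wpM2r Jb0 (C1C k).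
  lra.
- move=> e e0; have [K _ hK] := nbhs_infty_ger (2 / e).
  apply: filterS (kinfty K) => N /hK /=.
  rewrite /c ler_pdivrMr // ler_pdivrMr ?ltr0n // mulrC => /le_trans; apply.
  by rewrite ler_pM2l // ler_nat.
- apply: filterS kP => N [CJ nN]; have := mulr_ge0 (ltW (c0 (kappa N))) (ler0n R N).
  by split; lra.
Qed.
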